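(* Let $q=mf+1$ be a power of a prime, with $m,f$ positive integers. Suppose $f-1=\lambda m$ with $\lambda$ a nonnegative integer, and let $\chi$ be a multiplicative character of order $m$ on $\mathbb{F}_q$. Then $H_{q,m}$ is a $(q,f,\lambda)$-difference set in $\mathbb{F}_q$ if and only if $$\sum_{\alpha\in H_{q,m}}\chi^s(1-\alpha)=0,\quad s=1,\ldots,m-1.$$
   Context: $H_{q,m}$ denotes the set of nonzero $m$th powers in $\mathbb{F}_q$. A subset $D\subseteq\mathbb{F}_q$ of size $k$ is a $(q,k,\lambda)$-difference set in $\mathbb{F}_q$ if for each nonzero $a\in\mathbb{F}_q$ there are exactly $\lambda$ ordered pairs $(x,y)\in D\times D$ with $x-y=a$. A multiplicative character on $\mathbb{F}_q$ is a homomorphism $\mathbb{F}_q^*\to\mathbb{C}^*$ extended to $0$ by the value $1$ if the character is trivial and $0$ if it is nontrivial. For $s\in\mathbb{Z}$, $\chi^s$ is the $s$th power of $\chi$ as a character of $\mathbb{F}_q^*$, extended to $0$ by this same rule (so $\chi^s(0)=1$ if $m\mid s$ and $\chi^s(0)=0$ otherwise, where $m$ is the order of $\chi$). *)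

(* Defs.v *)
From HB Require Import structures.
From mathcomp Require Import all_boot all_order all_algebra.
From mathcomp Require Import reals complex.

Set Implicit Arguments.
Unset Strict Implicit.
Unset Printing Implicit Defensive.

Import Order.TTheory GRing.Theory Num.Theory.
Local Open Scope ring_scope.

Definition nonzero_powers (F : finFieldType) (m : nat) : {set F} :=
  [set a | (a != 0) && [exists x, a == x ^+ m]].

Definition difference_set (F : finFieldType) (D : {set F})
    (q k lambda : nat) : Prop :=
  [/\ #|F| = q, #|D| = k &
      forall a : F, a != 0 ->
        #|[set p : F * F | [&& p.1 \in D, p.2 \in D & p.1 - p.2 == a]]|
        = lambda].

Section MultiplicativeCharacters.
Variables (F : finFieldType) (C : fieldType).
Implicit Type chi : F -> C.

(* Triviality concerns the restriction to F^* only; chi 0 is not inspected. *)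
Definition char_trivial chi : bool :=
  [forall x : F, (x != 0) ==> (chi x == 1)].

Definition extend0 chi : F -> C :=
  fun x => if x == 0 then (if char_trivial chi then 1 else 0) else chi x.

(* The first two clauses say that chi restricts to a homomorphism F^* -> C^*. *)
Definition mult_char chi : Prop :=
  [/\ forall x, x != 0 -> chi x != 0,
      forall x y, x != 0 -> y != 0 -> chi (x * y) = chi x * chi y &
      chi 0 = if char_trivial chi then 1 else 0].

(* The value at 0 is reassigned according to whether the power is trivial; it
   is not the power of chi 0. *)
Definition char_exp chi (s : int) : F -> C := extend0 (fun x => chi x ^ s).

Definition char_has_order chi (m : nat) : Prop :=
  [/\ (0 < m)%N, char_trivial (char_exp chi m%:Z) &
      forall n : nat, (0 < n)%N -> char_trivial (char_exp chi n%:Z) ->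
        (m <= n)%N].

End MultiplicativeCharacters.

(* Main.v *)
Require Import Defs.
From mathcomp Require Import all_boot all_order all_algebra all_solvable all_field.
From mathcomp Require Import reals complex.

Set Implicit Arguments.
Unset Strict Implicit.
Unset Printing Implicit Defensive.

Import Order.TTheory GRing.Theory Num.Theory.
Local Open Scope ring_scope.

(** Write H for the group of nonzero m-th powers of F.  A character chi of
    order m maps a generator of F^* to a primitive m-th root of unity
    ([chi_primitive_root]), so chi takes F^* onto the m-th roots of unity and
    its kernel is exactly H ([mem_nonzero_powers]).

    Let b be nonzero.  A representation b = x - y with x, y in H is
    b = x (1 - alpha) with alpha = y / x in H, where alpha is not 1; conversely
    alpha determines x = b / (1 - alpha), which lies in H exactly when
    chi (1 - alpha) = chi b.  Hence b has as many representations as there are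
    alpha in H \ {1} with chi (1 - alpha) = chi b ([card_representations]).  So
    H is a difference set if and only if chi (1 - alpha), for alpha in H \ {1},
    takes every m-th root of unity equally often, the common multiplicity being
    then (f - 1) / m = lambda.

    By Fourier inversion on the cyclic group of m-th roots of unity, a family
    of such roots is equidistributed if and only if its power sums of exponents
    1, ..., m - 1 vanish ([equidistributedP]).  These power sums are the sums
    of the theorem, since the term alpha = 1 contributes chi^s(0) = 0. *)

(** * Equidistribution of roots of unity *)

Section Equidistribution.
Variables (C : numFieldType) (m : nat).
Hypothesis m_gt0 : (0 < m)%N.

Lemma sum_powers_unity_root (w : C) :
  w ^+ m = 1 -> \sum_(s < m) w ^+ s = if w == 1 then m%:R else 0.
Proof.
move=> wm1; case: eqVneq => [->|w_neq1].
  by under eq_bigr do rewrite expr1n; rewrite sumr_const card_ord.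
have := subrX1 w m; rewrite wm1 subrr => /esym/eqP.
by rewrite mulf_eq0 subr_eq0 (negPf w_neq1) => /eqP.
Qed.

(** Fourier inversion: m times the multiplicity of w is the sum over s < m of
    w^-s times the s-th power sum, and the 0-th power sum is the size of A.  The
    converse evaluates the power sums by grouping equal values. *)
Lemma equidistributedP (z : C) (T : finType) (A : {set T}) (v : T -> C) :
    m.-primitive_root z -> (forall t, t \in A -> v t ^+ m = 1) ->
  (forall s, (1 <= s <= m - 1)%N -> \sum_(t in A) v t ^+ s = 0) <->
  (forall w, w ^+ m = 1 -> (#|[set t in A | v t == w]| * m)%N = #|A|).
Proof.
move=> zP vm1; split=> [sums0 w wm1 | cards s /andP[s_gt0 s_lt]].
  have w_neq0 : w != 0.
    by apply/eqP=> w0; move/eqP: wm1; rewrite w0 expr0n gtn_eqF // eq_sym oner_eq0.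
  have E : \sum_(s < m) \sum_(t in A) (v t / w) ^+ s =
           (#|[set t in A | v t == w]| * m)%:R.
    rewrite exchange_big /=.
    have F t : t \in A ->
        \sum_(s < m) (v t / w) ^+ s = if v t == w then m%:R else 0.
      move=> tA; rewrite sum_powers_unity_root.
        by rewrite -[X in _ == X](divff w_neq0) (inj_eq (divIf w_neq0)).
      by rewrite expr_div_n vm1 // wm1 divr1.
    rewrite (eq_bigr _ F) -big_mkcondr /= sumr_const natrM mulr_natl.
    by congr (_ *+ _); apply: eq_card => t; rewrite inE.
  apply/eqP; rewrite -(eqr_nat C) -E.
  rewrite (bigD1 (Ordinal m_gt0)) //= [X in _ + X]big1 ?addr0 => [|s s_neq0].
    by under eq_bigr do rewrite expr0; rewrite sumr_const.
  under eq_bigr do rewrite expr_div_n.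
  rewrite -mulr_suml sums0 ?mul0r // lt0n subn1 -ltnS prednK // ltn_ord andbT.
  by move: s_neq0; rewrite -val_eqE.
have m_neq0 : (m%:R : C) != 0 by rewrite pnatr_eq0 -lt0n.
apply/eqP; rewrite -(mulrI_eq0 _ (mulfI m_neq0)); apply/eqP.
(* The index of v t among the powers of z; the default is never reached. *)
pose idx t := odflt (Ordinal m_gt0) [pick i : 'I_m | v t == z ^+ i].
have idxE t (i : 'I_m) : t \in A -> (idx t == i) = (v t == z ^+ i).
  move=> tA; rewrite /idx; case: pickP => [j /eqP-> | none] /=.
    by rewrite (eq_prim_root_expr zP) !modn_small.
  by have [j vj] := prim_rootP zP (vm1 t tA); have := none j; rewrite vj eqxx.
rewrite (partition_big idx xpredT) //= mulr_sumr.
rewrite (eq_bigr (fun i : 'I_m => #|A|%:R * (z ^+ s) ^+ i)) => [|i _].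
  rewrite -mulr_sumr sum_powers_unity_root; last first.
    by rewrite -exprM mulnC exprM (prim_expr_order zP) expr1n.
  rewrite -(prim_order_dvd zP) gtnNdvd ?mulr0 //.
  by rewrite -(prednK m_gt0) ltnS -subn1.
have zi1 : (z ^+ i) ^+ m = 1.
  by rewrite -exprM mulnC exprM (prim_expr_order zP) expr1n.
rewrite -(cards _ zi1) (eq_bigr (fun=> (z ^+ s) ^+ i)) => [|t /andP[tA]].
  rewrite sumr_const mulrnAr -mulrnAl -mulrnA mulnC; congr (_ *+ (_ * _) * _).
  by apply: eq_card => t; rewrite !inE unfold_in; apply: andb_id2l => /idxE.
by rewrite idxE // => /eqP->; rewrite -!exprM mulnC.
Qed.

End Equidistribution.

(** * Characters of order m *)

Lemma finField_unity_root (F : finFieldType) (x : F) :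
  x != 0 -> x ^+ #|F|.-1 = 1.
Proof.
move=> x0; apply: (mulfI x0).
by rewrite -exprS prednK ?mulr1 ?expf_card // ltnW ?finNzRing_gt1.
Qed.

(** The #|F| - 1 nonzero elements are all roots of X^(#|F| - 1) - 1, which
    forces one of them to be primitive: F^* is cyclic. *)
Lemma finField_primitive_root (F : finFieldType) :
  exists2 g : F, g != 0 & #|F|.-1.-primitive_root g.
Proof.
have q_gt0 : (0 < #|F|.-1)%N by rewrite -subn1 subn_gt0 finNzRing_gt1.
have: has #|F|.-1.-primitive_root (enum [pred x : F | x != 0]).
  apply: has_prim_root => //; last 2 first.
  - exact: enum_uniq.
  - rewrite -cardE -(cardC1 (0 : F)).
    by apply: subset_leq_card; apply/subsetP => x; rewrite !inE.
  apply/allP=> x; rewrite mem_enum inE unity_rootE => x_neq0.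
  by apply/eqP/finField_unity_root.
by move/hasP=> [g]; rewrite mem_enum => g0 gP; exists g.
Qed.

Section CharacterOfOrder.
Variables (F : finFieldType) (C : numFieldType) (m : nat) (chi : F -> C).
Hypotheses (chi_char : mult_char chi) (chi_order : char_has_order chi m).

Let m_gt0 : (0 < m)%N. Proof. by case: chi_order. Qed.

Lemma chiM x y : x != 0 -> y != 0 -> chi (x * y) = chi x * chi y.
Proof. by case: chi_char => _ + _; apply. Qed.

Lemma chi_neq0 x : x != 0 -> chi x != 0.
Proof. by case: chi_char => + _ _; apply. Qed.

Lemma chi1 : chi 1 = 1.
Proof.
have one_neq0 := oner_neq0 F.
by apply: (mulfI (chi_neq0 one_neq0)); rewrite -chiM // !mulr1.
Qed.

Lemma chiX x n : x != 0 -> chi (x ^+ n) = chi x ^+ n.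
Proof.
move=> x_neq0; elim: n => [|n IHn]; first by rewrite !expr0 chi1.
by rewrite !exprS chiM ?expf_neq0 // IHn.
Qed.

Lemma chi_div x y : x != 0 -> y != 0 -> chi (x / y) = chi x / chi y.
Proof.
move=> x0 y0; apply: (mulIf (chi_neq0 y0)).
by rewrite -chiM ?mulf_neq0 ?invr_neq0 // !divfK // chi_neq0.
Qed.

Lemma char_exp_neq0 n x : x != 0 -> char_exp chi n%:Z x = chi x ^+ n.
Proof. by rewrite /char_exp /extend0 => /negPf->. Qed.

Lemma char_trivial_expP n :
  reflect (forall x, x != 0 -> chi x ^+ n = 1) (char_trivial (char_exp chi n%:Z)).
Proof.
apply: (iffP forallP) => [triv x x0 | triv x].
  by have := triv x; rewrite x0 char_exp_neq0 // => /eqP.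
by apply/implyP=> x0; rewrite char_exp_neq0 // triv.
Qed.

Lemma chi_unity_root x : x != 0 -> chi x ^+ m = 1.
Proof. by case: chi_order => _ /char_trivial_expP + _; apply. Qed.

Lemma char_exp0 s : (1 <= s <= m - 1)%N -> char_exp chi s%:Z 0 = 0.
Proof.
move=> /andP[s_gt0 s_lt]; rewrite /char_exp /extend0 eqxx.
case: ifP => // triv.
have [_ _ m_min] := chi_order.
have : (m <= s)%N.
  apply: m_min => //; apply/char_trivial_expP => x x0.
  by have := forallP triv x; rewrite x0 => /eqP.
by rewrite leqNgt -[X in (_ < X)%N](prednK m_gt0) ltnS -subn1 s_lt.
Qed.

(** If k is the order of the root of unity chi g, then k divides m.  Every
    nonzero x is a power of g, so chi^k is trivial, and m is the least positive
    exponent with this property. *)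
Lemma chi_primitive_root g :
  g != 0 -> #|F|.-1.-primitive_root g -> m.-primitive_root (chi g).
Proof.
move=> g0 gP.
have [k kP k_dvd] := prim_order_exists m_gt0 (chi_unity_root g0).
suff <- : k = m by [].
apply/eqP; rewrite eqn_leq (dvdn_leq m_gt0 k_dvd) /=.
have [_ _ m_min] := chi_order; apply: m_min; first exact: prim_order_gt0 kP.
apply/char_trivial_expP => x x0.
have [i ->] := prim_rootP gP (finField_unity_root x0).
by rewrite chiX // -exprM mulnC exprM (prim_expr_order kP) expr1n.
Qed.

(** The value of chi at g^i is z^i for a primitive m-th root of unity z, so it
    is 1 exactly when m divides i. *)
Lemma mem_nonzero_powers x :
  (x \in nonzero_powers F m) = (x != 0) && (chi x == 1).
Proof.
rewrite inE; apply: andb_id2l => x0; apply/existsP/eqP => [[y /eqP xE]|chix1].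
  suff y0 : y != 0 by rewrite xE chiX // chi_unity_root.
  by apply: contraNneq x0 => y0; rewrite xE y0 expr0n gtn_eqF.
have [g g0 gP] := finField_primitive_root F.
have [i xE] := prim_rootP gP (finField_unity_root x0).
move: chix1; rewrite xE chiX // => /eqP.
rewrite -(prim_order_dvd (chi_primitive_root g0 gP)) => /dvdnP[k ->].
by exists (g ^+ k); rewrite exprM.
Qed.

Lemma chi_surj w : w ^+ m = 1 -> exists2 x, x != 0 & chi x = w.
Proof.
move=> wm1; have [g g0 gP] := finField_primitive_root F.
have [i ->] := prim_rootP (chi_primitive_root g0 gP) wm1.
by exists (g ^+ i); rewrite ?expf_neq0 ?chiX.
Qed.

(** The bijection sends alpha to (x, x alpha) with x = b / (1 - alpha); its
    inverse is (x, y) |-> y / x. *)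
Lemma card_representations b : b != 0 ->
  #|[set p : F * F | [&& p.1 \in nonzero_powers F m,
       p.2 \in nonzero_powers F m & p.1 - p.2 == b]]| =
  #|[set a in nonzero_powers F m :\ 1 | chi (1 - a) == chi b]|.
Proof.
move=> b0; set D := [set a in _ | _].
have D_neq0 a : a \in D -> 1 - a != 0.
  by rewrite !inE subr_eq0 eq_sym => /andP[/andP[]].
pose h (a : F) := (b / (1 - a), b / (1 - a) * a).
have h_inj : {in D &, injective h}.
  move=> a c aD cD [e1 e2].
  have x0 : b / (1 - a) != 0 by rewrite mulf_neq0 ?invr_neq0 ?D_neq0.
  by apply: (mulfI x0); rewrite e2 e1.
rewrite -(card_in_imset h_inj); apply: eq_card => -[x y].
apply/idP/imsetP => [|[a aD [-> ->]]]; last first.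
  have a1 := D_neq0 a aD; move: aD; rewrite /D in_set => /andP[].
  rewrite !in_setD1 mem_nonzero_powers => /andP[_ /andP[a0 /eqP chia]] /eqP chi1a.
  have x0 : b / (1 - a) != 0 by rewrite mulf_neq0 ?invr_neq0.
  rewrite inE /= !mem_nonzero_powers (mulf_neq0 x0 a0) x0 (chiM x0 a0) chia mulr1.
  rewrite chi_div // chi1a divff ?chi_neq0 // eqxx /=.
  by rewrite -[X in X - _]mulr1 -mulrBr divfK.
rewrite inE /= !mem_nonzero_powers.
move=> /and3P[/andP[x0 /eqP chix] /andP[y0 /eqP chiy] /eqP bE].
have bE' : b = x * (1 - y / x) by rewrite mulrBr mulr1 mulrCA divff // mulr1.
have a1 : 1 - y / x != 0 by apply: contraNneq b0 => e; rewrite bE' e mulr0.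
exists (y / x); last first.
  have xE : b / (1 - y / x) = x by rewrite bE' mulfK.
  by rewrite /h xE mulrCA divff // mulr1.
rewrite inE in_setD1 mem_nonzero_powers mulf_neq0 ?invr_neq0 //.
rewrite chi_div // chix chiy divr1 eqxx /= andbT eq_sym -subr_eq0 a1 /=.
by rewrite [in X in _ == X]bE' chiM // chix mul1r.
Qed.

End CharacterOfOrder.

(** * The group of nonzero powers as a difference set *)

(** With g a generator of F^*, the powers g^(m i) for i < f list the nonzero
    m-th powers without repetition, since g has order m f. *)
Lemma card_nonzero_powers (F : finFieldType) (m f : nat) :
  (0 < m)%N -> #|F| = (m * f + 1)%N -> #|nonzero_powers F m| = f.
Proof.
move=> m_gt0 cardF; have [g g0 gP] := finField_primitive_root F.
move: (gP); rewrite cardF addn1 /= => gP'.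
have h_inj : injective (fun i : 'I_f => g ^+ (m * i)).
  move=> i j /eqP; rewrite (eq_prim_root_expr gP') -!muln_modr.
  by rewrite eqn_pmul2l // !modn_small // => /eqP/val_inj.
rewrite -[RHS]card_ord -(card_imset _ h_inj); apply: eq_card => x.
rewrite inE; apply/andP/imsetP => [[x0 /existsP[y /eqP xE]] | [i _ ->]]; last first.
  by rewrite expf_neq0 //; split=> //; apply/existsP; exists (g ^+ i); rewrite mulnC exprM.
have y0 : y != 0 by apply: contraNneq x0 => y0; rewrite xE y0 expr0n gtn_eqF.
have := finField_unity_root y0; rewrite cardF addn1 /= => yq1.
have [i yE] := prim_rootP gP' yq1.
have f_gt0 : (0 < f)%N by have := prim_order_gt0 gP'; rewrite muln_gt0 => /andP[].
exists (Ordinal (ltn_pmod i f_gt0)) => //=.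
apply/eqP; rewrite xE yE -exprM (eq_prim_root_expr gP').
by rewrite mulnC muln_modr modn_mod.
Qed.

Theorem theorem3p1 (R : realType) (F : finFieldType) (q m f lambda : nat)
    (m_gt0 : (0 < m)%N) (f_gt0 : (0 < f)%N)
    (q_def : q = (m * f + 1)%N) (cardF : #|F| = q)
    (f_def : (f - 1)%N = (lambda * m)%N)
    (chi : F -> R[i]) (chi_char : mult_char chi)
    (chi_order : char_has_order chi m) :
  difference_set (nonzero_powers F m) q f lambda <->
  (forall s : nat, (1 <= s <= m - 1)%N ->
     \sum_(alpha in nonzero_powers F m) char_exp chi s%:Z (1 - alpha) = 0).
Proof.
have cardF' : #|F| = (m * f + 1)%N by rewrite cardF.
have cardH := card_nonzero_powers m_gt0 cardF'.
set H := nonzero_powers F m in cardH *.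
have one_H : 1 \in H.
  by rewrite inE oner_eq0; apply/existsP; exists 1; rewrite expr1n.
have sub_neq0 a : a \in H :\ 1 -> 1 - a != 0.
  by rewrite in_setD1 subr_eq0 eq_sym => /andP[].
have cardA : #|H :\ 1| = (lambda * m)%N.
  by rewrite -f_def -cardH (cardsD1 1 H) one_H addKn.
have sumE s : (1 <= s <= m - 1)%N ->
    \sum_(a in H) char_exp chi s%:Z (1 - a) = \sum_(a in H :\ 1) chi (1 - a) ^+ s.
  move=> s_bnd; rewrite (big_setD1 1) //= subrr (char_exp0 chi_order) //.
  by rewrite add0r; apply: eq_bigr => a /sub_neq0; apply: char_exp_neq0.
have [g g0 gP] := finField_primitive_root F.
have zP := chi_primitive_root chi_char chi_order g0 gP.
have vm1 a : a \in H :\ 1 -> chi (1 - a) ^+ m = 1.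
  by move/sub_neq0; apply: chi_unity_root.
have [sums_cards cards_sums] := equidistributedP m_gt0 zP vm1.
split=> [[_ _ dset] s s_bnd | sums0].
  rewrite sumE //; apply: cards_sums => // w wm1.
  have [b b0 <-] := chi_surj chi_char chi_order wm1.
  by rewrite -(card_representations chi_char chi_order) // dset.
split=> // b b0; rewrite (card_representations chi_char chi_order) //.
apply/eqP; rewrite -(eqn_pmul2r m_gt0) -cardA; apply/eqP/sums_cards.
  by move=> s s_bnd; rewrite -sumE ?sums0.
exact: chi_unity_root chi_order _ b0.
Qed.
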